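(* Let $n,d\ge 1$ be integers and let $B$ be a solution in $[n]^d$. Then the following statements are equivalent: (0) $B$ is convex. (1) $B$ is perfect. (2) $M_B$ is a Latin hypercube (of dimension $d-1$ and order $n$, whose $n$ symbols are the singleton sets $\{1\},\dots,\{n\}$). (3) There is a balanced dismantling of $[n]^d$ to $B$. (4) Every dismantling of $[n]^d$ to $B$ is balanced. (5) There is a balanced build-up from $B$ to $[n]^d$. (6) Every build-up from $B$ to $[n]^d$ is balanced.
   Context: $[n]^d$ denotes the graph whose vertices (also called cubes) are the $d$-tuples $(x_1,\dots,x_d)$ with $x_i\in\{1,\dots,n\}$; two vertices are neighbours if they differ in exactly one coordinate, and in that coordinate by exactly $1$. A line is a set of $n$ vertices obtained by fixing $d-1$ coordinates and letting the remaining one vary. A position is any subset of the vertices of $[n]^d$; its vertices are called black and the remaining vertices are called white. A dismantling move removes from the current position a black vertex having exactly $d$ black neighbours in the current position; a build-up move adds to the current position a white vertex having exactly $d$ black neighbours in the current position. A dismantling from $P$ to $Q$ (respectively a build-up from $P$ to $Q$) is a finite sequence of dismantling (respectively build-up) moves transforming position $P$ into position $Q$. A move that removes or adds the vertex $v$ is balanced if the $d$ black neighbours of $v$ lie in $d$ different lines through $v$ (one in each of the $d$ coordinate directions); a dismantling or build-up is balanced if all its moves are balanced. A base position is a set of $n^{d-1}$ pairwise non-neighbouring vertices. A solution is a base position that can be reached by a dismantling from $[n]^d$. A position is convex if no line contains one or more white vertices between two black vertices. A base position is perfect if each of its $d$ projections to $[n]^{d-1}$ (obtained by omitting one coordinate)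 is surjective onto $[n]^{d-1}$. For a position $P$, $M_P=[m_{x_1\cdots x_{d-1}}]$ is the $(d-1)$-dimensional array of sets defined by $z\in m_{x_1\cdots x_{d-1}}$ if and only if $(x_1,\dots,x_{d-1},z)\in P$. A Latin hypercube of dimension $k$ and order $n$ is a $k$-dimensional $n\times\cdots\times n$ array of $n$ symbols in which each symbol occurs exactly once in each line. *)

(* Defs.v *)
From mathcomp Require Import all_boot.

Set Implicit Arguments.
Unset Strict Implicit.
Unset Printing Implicit Defensive.

(* Coordinates range over 'I_n, i.e. {0, ..., n-1}, instead of {1, ..., n}. *)
Notation cube n d := {ffun 'I_d -> 'I_n}.

Definition line n d (i : 'I_d) (x : cube n d) : {set cube n d} :=
  [set y : cube n d | [forall (j | j != i), y j == x j]].

Definition neighbours n d (x y : cube n d) : bool :=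
  [exists i : 'I_d, (y \in line i x) &&
    (((x i).+1 == y i :> nat) || ((y i).+1 == x i :> nat))].

Definition black_neighbours n d (P : {set cube n d}) (v : cube n d) :
  {set cube n d} := [set u in P | neighbours v u].

Definition dismantling_move n d (P : {set cube n d}) (v : cube n d) : bool :=
  (v \in P) && (#|black_neighbours P v| == d).

Definition buildup_move n d (P : {set cube n d}) (v : cube n d) : bool :=
  (v \notin P) && (#|black_neighbours P v| == d).

(* P is the position before the move; as v is not its own neighbour, whether v
   itself belongs to P is irrelevant. *)
Definition balanced_move n d (P : {set cube n d}) (v : cube n d) : bool :=
  [forall i : 'I_d, #|black_neighbours P v :&: line i v| == 1].

(* A dismantling or build-up starting at P is given by the sequence s of the
   vertices successively removed or added. *)
Fixpoint dismantling n d (P : {set cube n d}) (s : seq (cube n d))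
    (Q : {set cube n d}) : bool :=
  if s is v :: s' then dismantling_move P v && dismantling (P :\ v) s' Q
  else P == Q.

Fixpoint buildup n d (P : {set cube n d}) (s : seq (cube n d))
    (Q : {set cube n d}) : bool :=
  if s is v :: s' then buildup_move P v && buildup (v |: P) s' Q
  else P == Q.

Fixpoint balanced_dismantling n d (P : {set cube n d}) (s : seq (cube n d)) :
    bool :=
  if s is v :: s' then balanced_move P v && balanced_dismantling (P :\ v) s'
  else true.

Fixpoint balanced_buildup n d (P : {set cube n d}) (s : seq (cube n d)) :
    bool :=
  if s is v :: s' then balanced_move P v && balanced_buildup (v |: P) s'
  else true.

Definition base_position n d (B : {set cube n d}) : bool :=
  (#|B| == n ^ d.-1) &&
  [forall x in B, forall y in B, ~~ neighbours x y].

Definition solution n d (B : {set cube n d}) : Prop :=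
  base_position B /\ exists s, dismantling [set: cube n d] s B.

Definition convex n d (P : {set cube n d}) : Prop :=
  forall (i : 'I_d) (x y z : cube n d),
    x \in P -> z \in P -> y \in line i x -> z \in line i x ->
    x i < y i -> y i < z i -> y \in P.

Definition projection n d (i : 'I_d) (x : cube n d) : cube n d.-1 :=
  [ffun j => x (lift i j)].

Definition perfect n d (B : {set cube n d}) : Prop :=
  forall i : 'I_d, projection i @: B = [set: cube n d.-1].

(* (x_1, ..., x_(d-1), z) *)
Definition append n d (x : cube n d.-1) (z : 'I_n) : cube n d :=
  [ffun j : 'I_d => if insub (val j) is Some k then x k else z].

Definition set_array n d (P : {set cube n d}) :
  {ffun cube n d.-1 -> {set 'I_n}} :=
  [ffun x => [set z | append x z \in P]].

(* S is the set of symbols. In dimension 0 there is a single entry and no line,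
   so the only requirement on A is that this entry be a symbol. *)
Definition latin_hypercube (T : finType) n k (S : {set T})
    (A : {ffun cube n k -> T}) : Prop :=
  [/\ #|S| = n,
      forall x, A x \in S &
      forall (i : 'I_k) (x : cube n k) (s : T), s \in S ->
        #|[set y in line i x | A y == s]| = 1].

(* Main.v *)
Require Import Defs.
From mathcomp Require Import all_boot.

Set Implicit Arguments.
Unset Strict Implicit.
Unset Printing Implicit Defensive.

(* Convexity of B, perfection of B and the Latin property of M_B all say that B
   meets each line exactly once (for convexity: no two vertices of B are
   neighbours, and |B| is the number of lines in each direction).
   A balanced move takes an end of an interval of black vertices in each
   direction, so it preserves convexity; hence a balanced dismantling of the
   convex position [n]^d ends in a convex position.  Conversely, if P is convex
   and the black vertex v is removed on the way to a position meeting all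
   lines, then v has a black neighbour in each of the d lines through it; if it
   has only d black neighbours, the move is balanced.
   Build-ups are reversed dismantlings. *)

(** * Lines and neighbours *)

Lemma lineP n d (i : 'I_d) (x y : cube n d) :
  reflect (forall j, j != i -> y j = x j) (y \in line i x).
Proof.
rewrite inE; apply: (iffP forall_inP) => h j ji; first exact/eqP/h.
by apply/eqP/h.
Qed.

Lemma line_projection n d (i : 'I_d) (x y : cube n d) :
  (y \in line i x) = (projection i y == projection i x).
Proof.
apply/lineP/eqP => [h | /ffunP h j].
  by apply/ffunP => j; rewrite !ffunE h // eq_sym neq_lift.
by rewrite eq_sym => /unlift_some[k -> _]; have := h k; rewrite !ffunE.
Qed.

Lemma line_sym n d (i : 'I_d) (x y : cube n d) :
  (y \in line i x) = (x \in line i y).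
Proof. by rewrite !line_projection eq_sym. Qed.

Lemma line_trans n d (i : 'I_d) (x y z : cube n d) :
  y \in line i x -> z \in line i y -> z \in line i x.
Proof. by rewrite !line_projection => /eqP <-. Qed.

Lemma line_inj n d (i : 'I_d) (x y : cube n d) :
  y \in line i x -> y i = x i -> y = x.
Proof.
by move=> /lineP h e; apply/ffunP => j; have [->|/h] := eqVneq j i.
Qed.

Lemma line_exists n d (i : 'I_d) (x : cube n d) (k : 'I_n) :
  exists2 y, y \in line i x & y i = k.
Proof.
exists [ffun j => if j == i then k else x j]; last by rewrite ffunE eqxx.
by apply/lineP => j /negPf ji; rewrite ffunE ji.
Qed.

Lemma neighboursP n d (x y : cube n d) :
  reflect (exists i, y \in line i x /\ ((x i).+1 = y i :> nat \/ (y i).+1 = x i :> nat))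
          (neighbours x y).
Proof.
apply: (iffP existsP) => [[i /andP[l /orP[]/eqP h]]|[i [l h]]]; exists i.
- by split=> //; left.
- by split=> //; right.
- by rewrite l; case: h => ->; rewrite eqxx ?orbT.
Qed.

Lemma neighbours_irr n d (x : cube n d) : neighbours x x = false.
Proof.
by apply/neighboursP => -[i [_ []]] /eqP; rewrite (gtn_eqF (ltnSn _)).
Qed.

Lemma black_neighboursD1 n d (P : {set cube n d}) v :
  black_neighbours (P :\ v) v = black_neighbours P v.
Proof.
apply/setP => u; rewrite !inE; case: eqP => //= ->.
by rewrite neighbours_irr andbF.
Qed.

(** A neighbour of [v] differs from [v] in a single coordinate, so it lies on exactly one line
    through [v]; exchanging the sums counts it once. *)
Lemma sum_black_neighbours n d (P : {set cube n d}) v :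
  \sum_(i < d) #|black_neighbours P v :&: line i v| = #|black_neighbours P v|.
Proof.
under eq_bigr do rewrite -sum1_card.
rewrite (exchange_big_dep (mem (black_neighbours P v))) /=; last first.
  by move=> i u _; rewrite inE => /andP[].
rewrite -sum1_card; apply: eq_bigr => u uP.
have /neighboursP[i [li hi]] : neighbours v u by move: uP; rewrite inE => /andP[].
rewrite (big_pred1 i) // => j; rewrite !inE.
apply/andP/eqP => [[_ h]|->]; last by split; [move: uP | move: li]; rewrite !inE.
apply/eqP/negP => /negP ij.
have /lineP/(_ i) : u \in line j v by rewrite inE.
rewrite eq_sym => /(_ ij) e.
by case: hi; rewrite e => /eqP; rewrite gtn_eqF.
Qed.

(** * Black neighbours in convex positions *)

Lemma convex_step_up n d (P : {set cube n d}) i v w :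
    convex P -> v \in P -> w \in P -> w \in line i v -> v i < w i ->
  exists u, u \in black_neighbours P v :&: line i v /\ u i = (v i).+1 :> nat.
Proof.
move=> cP vP wP lw lt.
have [u lu eu] := line_exists i v (Ordinal (leq_ltn_trans lt (ltn_ord _))).
exists u; split; last by rewrite eu.
rewrite !in_setI inE lu andbT; apply/andP; split; last first.
  by apply/neighboursP; exists i; rewrite eu; split=> //; left.
(* The cube [u] next to [v] towards [w] is either strictly between them, hence black by convexity,
   or [w] itself. *)
case: (ltngtP (u i) (w i)) => [h|h|/ord_inj h].
- by apply: (cP i v u w) => //; rewrite eu /=.
- by move: h; rewrite eu /= ltnNge lt.
- suff -> : u = w by [].
  by apply: (@line_inj _ _ i) => //; apply: line_trans lu; rewrite line_sym.
Qed.

Lemma convex_step_down n d (P : {set cube n d}) i v w :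
    convex P -> v \in P -> w \in P -> w \in line i v -> w i < v i ->
  exists u, u \in black_neighbours P v :&: line i v /\ (u i).+1 = v i :> nat.
Proof.
move=> cP vP wP lw lt.
have kn : (v i).-1 < n by apply: leq_ltn_trans (leq_pred _) (ltn_ord _).
have [u lu eu] := line_exists i v (Ordinal kn).
have ev : (u i).+1 = v i by rewrite eu /= prednK // (leq_ltn_trans _ lt).
exists u; split=> //.
rewrite !in_setI inE lu andbT; apply/andP; split; last first.
  by apply/neighboursP; exists i; split=> //; right.
have luw : u \in line i w by apply: line_trans lu; rewrite line_sym.
case: (ltngtP (u i) (w i)) => [h|h|/ord_inj h].
- by move: lt; rewrite -ev ltnS leqNgt h.
- by apply: (cP i w u v) => //; rewrite -?ev // line_sym.
- by rewrite (line_inj luw h).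
Qed.

Lemma convex_black_neighbour n d (P : {set cube n d}) i v w :
    convex P -> v \in P -> w \in P -> w \in line i v -> w != v ->
  exists u, u \in black_neighbours P v :&: line i v.
Proof.
move=> cP vP wP lw; case: (ltngtP (v i) (w i)) => [lt|lt|e] wv.
- by have [u [hu _]] := convex_step_up cP vP wP lw lt; exists u.
- by have [u [hu _]] := convex_step_down cP vP wP lw lt; exists u.
- by rewrite (line_inj lw (esym (ord_inj e))) eqxx in wv.
Qed.

(** * Convexity, injective projections and perfection *)

Lemma convexT n d : convex [set: cube n d].
Proof. by move=> i x y z; rewrite !inE. Qed.

(** Two cubes of [B] on a common line would, by convexity, give one of them a neighbour in [B]. *)
Lemma convex_injective n d (B : {set cube n d}) :
  base_position B -> convex B ->
  forall i, {in B &, injective (projection i)}.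
Proof.
move=> /andP[_ /forall_inP nB] cB i x y xB yB /esym/eqP.
rewrite -line_projection => lxy; apply/eqP/negP => /negP.
rewrite eq_sym => nxy.
have [u] := convex_black_neighbour cB xB yB lxy nxy.
rewrite !in_setI inE => /andP[/andP[uB xu] _].
by have /forall_inP/(_ u uB) := nB x xB; rewrite xu.
Qed.

Lemma injective_convex n d (B : {set cube n d}) :
  (forall i, {in B &, injective (projection i)}) -> convex B.
Proof.
move=> iB i x y z xB zB _; rewrite line_projection => /eqP e.
by rewrite (iB i z x) // => /ltn_trans h /h; rewrite ltnn.
Qed.

Lemma card_cube n d : #|[set: cube n d]| = n ^ d.
Proof. by rewrite cardsT card_ffun !card_ord. Qed.

(** Both [B] and the target of each projection have [n ^ d.-1] elements; the converse below rests on
    the same count. *)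
Lemma injective_perfect n d (B : {set cube n d}) :
  base_position B ->
  (forall i, {in B &, injective (projection i)}) -> perfect B.
Proof.
move=> /andP[/eqP cB _] iB i; apply/eqP.
by rewrite eqEcard subsetT card_cube card_in_imset // cB leqnn.
Qed.

Lemma perfect_injective n d (B : {set cube n d}) :
  base_position B -> perfect B ->
  forall i, {in B &, injective (projection i)}.
Proof.
by move=> /andP[/eqP cB _] pB i; apply/imset_injP; rewrite pB card_cube cB.
Qed.

Lemma perfect_meets_line n d (B : {set cube n d}) i v :
  perfect B -> exists2 w, w \in B & w \in line i v.
Proof.
move=> /(_ i)/setP/(_ (projection i v)); rewrite inE => /imsetP[w wB e].
by exists w; rewrite // line_projection e.
Qed.

(** * Perfection and Latin hypercubes *)

Lemma append_last n d (x : cube n d) (z : 'I_n) :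
  append (d := d.+1) x z ord_max = z.
Proof. by rewrite ffunE insubF //= ltnn. Qed.

Lemma append_lift n d (x : cube n d) (z : 'I_n) k :
  append (d := d.+1) x z (lift ord_max k) = x k.
Proof.
rewrite ffunE; case: insubP => [k' _ e|]; last by rewrite [val _]lift_max ltn_ord.
by congr (x _); apply: ord_inj; rewrite -[RHS](lift_max k) -e.
Qed.

Lemma append_projection n d (x : cube n d.+1) :
  append (projection ord_max x) (x ord_max) = x.
Proof.
apply/ffunP => j; have [k ->|->] := unliftP ord_max j.
  by rewrite append_lift ffunE.
by rewrite append_last.
Qed.

Lemma projection_append n d (x : cube n d) (z : 'I_n) :
  projection ord_max (append (d := d.+1) x z) = x.
Proof. by apply/ffunP => k; rewrite ffunE append_lift. Qed.

Lemma line_append n d (x y : cube n d) (z : 'I_n) (i : 'I_d) :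
  (append (d := d.+1) y z \in line (lift ord_max i) (append (d := d.+1) x z))
    = (y \in line i x).
Proof.
apply/lineP/lineP => h j ji.
  by have := h (lift ord_max j); rewrite !append_lift (inj_eq lift_inj); apply.
have [k jk|->] := unliftP ord_max j; last by rewrite !append_last.
by rewrite jk !append_lift h //; apply: contraNneq ji => <-; apply/eqP.
Qed.

Lemma in_set_array n d (B : {set cube n d}) x z :
  (z \in set_array B x) = (append x z \in B).
Proof. by rewrite ffunE inE. Qed.

(** Injectivity leaves at most one element in each entry, so an occurrence of a symbol in the array
    amounts to a cube of [B]. *)
Lemma set_array_singleton n d (B : {set cube n d.+1}) x z :
  {in B &, injective (projection ord_max)} ->
  (set_array B x == [set z]) = (append x z \in B).
Proof.
move=> iB; apply/eqP/idP => [h|xzB]; first by rewrite -in_set_array h inE.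
apply/setP => t; rewrite in_set_array inE; apply/idP/eqP => [xtB|-> //].
rewrite -(append_last x t) -(append_last x z).
by rewrite (iB _ _ xtB xzB) ?projection_append.
Qed.

(** Occurrences of [[set z]] on a line of the array correspond to cubes of [B] on a line at height
    [z]: perfection gives one, injectivity no more. *)
Lemma perfect_latin n d (B : {set cube n d.+1}) :
  base_position B -> perfect B ->
  latin_hypercube [set [set z] | z : 'I_n] (set_array B).
Proof.
move=> bB pB; have iB := perfect_injective bB pB; split.
- by rewrite card_imset ?card_ord //; apply: set1_inj.
- move=> x; have /setP/(_ x) := pB ord_max.
  rewrite inE => /imsetP[w wB ->]; apply/imsetP; exists (w ord_max) => //.
  by apply/eqP; rewrite set_array_singleton // append_projection.
- move=> i x _ /imsetP[z _ ->].
  have [b bB' lb] := perfect_meets_line (lift ord_max i) (append x z) pB.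
  have bz : b ord_max = z.
    by move/lineP/(_ ord_max (neq_lift _ _)): (lb); rewrite append_last.
  have eb := append_projection b; rewrite bz in eb.
  apply/eqP/cards1P; exists (projection ord_max b); apply/setP => y.
  rewrite in_set1 in_set /= set_array_singleton //.
  apply/andP/eqP => [[ly yB]|->]; last first.
    by rewrite -(line_append _ _ z) /= eb.
  suff <- : append (d := d.+1) y z = b by rewrite projection_append.
  apply: (iB (lift ord_max i)) => //; apply/eqP.
  by rewrite -line_projection (@line_trans _ _ _ _ (append x z)) // ?line_append // line_sym.
Qed.

(** In the last direction, each entry is a singleton. In any other, two cubes of [B] on a line share
    their last coordinate, so they are occurrences of one symbol on one line of the array. *)
Lemma latin_injective n d (B : {set cube n d.+1}) :
  latin_hypercube [set [set z] | z : 'I_n] (set_array B) ->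
  forall i, {in B &, injective (projection i)}.
Proof.
move=> [_ AS AL].
have imax : {in B &, injective (projection ord_max)}.
  move=> x y xB yB e; apply: (@line_inj _ _ ord_max).
    by rewrite line_projection e.
  have /imsetP[t _ et] := AS (projection ord_max x).
  have := in_set_array B (projection ord_max x) (x ord_max).
  have := in_set_array B (projection ord_max x) (y ord_max).
  by rewrite {2}e !append_projection xB yB et !inE => /eqP-> /eqP->.
move=> i x y xB yB e; have [k ik|im] := unliftP ord_max i; last first.
  by apply: imax; rewrite -?im.
have lxy : y \in line (lift ord_max k) x by rewrite line_projection -ik e.
have exy : y ord_max = x ord_max by apply: (lineP _ _ _ lxy); apply: neq_lift.
apply: (imax) => //.
have := AL k (projection ord_max x) [set x ord_max] (imset_f _ isT).
move=> /eqP/cards1P[p /setP ep].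
have /set1P -> : projection ord_max x \in [set p].
  by rewrite -ep in_set /= set_array_singleton // append_projection xB line_projection eqxx.
apply/esym/set1P.
rewrite -ep in_set /= set_array_singleton // -exy append_projection yB andbT.
by rewrite -(line_append _ _ (x ord_max)) append_projection -exy append_projection.
Qed.

(** * Balanced moves and convexity *)

Lemma balanced_convex n d (P : {set cube n d}) v :
  convex P -> v \in P -> balanced_move P v -> convex (P :\ v).
Proof.
move=> cP vP /forallP bv i x y z; rewrite !in_setD1.
move=> /andP[_ xP] /andP[_ zP] ly lz lxy lyz.
(* Convexity can fail only at [y = v]; then [v] would have a black neighbour on either side in
   direction [i], against balance. *)
rewrite (cP i x y z) // andbT; apply/eqP => yv.
rewrite yv in ly lxy lyz.
have lx : x \in line i v by rewrite line_sym.
have lz' : z \in line i v := line_trans lx lz.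
have [a [ha ea]] := convex_step_up cP vP zP lz' lyz.
have [b [hb eb]] := convex_step_down cP vP xP lx lxy.
have /cards1P[c ec] := bv i.
move: ha hb ea eb; rewrite ec => /set1P -> /set1P -> -> /eqP.
by rewrite gtn_eqF // ltnW.
Qed.

Lemma balanced_dismantling_convex n d (s : seq (cube n d)) P Q :
  convex P -> dismantling P s Q -> balanced_dismantling P s -> convex Q.
Proof.
elim: s P => [|v s IHs] P cP /= => [/eqP <- //|].
move=> /andP[/andP[vP _] dP] /andP[bv bP].
by apply: IHs dP bP; apply: balanced_convex.
Qed.

Lemma dismantling_sub n d (s : seq (cube n d)) P Q :
  dismantling P s Q -> Q \subset P.
Proof.
elim: s P => [|v s IHs] P /= => [/eqP-> //|/andP[_ /IHs h]].
by apply: subset_trans h (subsetDl _ _).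
Qed.

(** Each line through [v] meets [Q] in a cube other than [v], so convexity gives at least one black
    neighbour per direction; there are only [d] in all. *)
Lemma perfect_balanced_move n d (P Q : {set cube n d}) v :
    convex P -> perfect Q -> Q \subset P :\ v -> dismantling_move P v ->
  balanced_move P v.
Proof.
move=> cP pQ sQ /andP[vP /eqP cv].
have ge1 i : 1 <= #|black_neighbours P v :&: line i v|.
  have [w wQ lw] := perfect_meets_line i v pQ.
  have := subsetP sQ w wQ; rewrite in_setD1 => /andP[wv wP].
  have [u hu] := convex_black_neighbour cP vP wP lw wv.
  by apply/card_gt0P; exists u.
(* Both sides of the summed bounds equal [d], so every bound [ge1 i] is an equality. *)
have := @leqif_sum _ xpredT (fun i : 'I_d => 1 == #|black_neighbours P v :&: line i v|)
  _ _ (fun i _ => leqif_eq (ge1 i)).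
rewrite sum_black_neighbours cv sum1_card card_ord => -[_].
rewrite eqxx => /esym/forallP h.
by apply/forallP => i; rewrite eq_sym; exact: h.
Qed.

(** The balance of a move keeps the position convex, which in turn gives the balance of the next
    move. *)
Lemma perfect_balanced_dismantling n d (s : seq (cube n d)) P Q :
  convex P -> perfect Q -> dismantling P s Q -> balanced_dismantling P s.
Proof.
move=> cP pQ; elim: s P cP => [//|v s IHs] P cP /= /andP[mv ds].
have bv := perfect_balanced_move cP pQ (dismantling_sub ds) mv.
rewrite bv; apply: IHs ds; apply: balanced_convex => //.
by case/andP: mv.
Qed.

(** * Build-ups as reversed dismantlings *)

Lemma balanced_moveD1 n d (P : {set cube n d}) v :
  balanced_move (P :\ v) v = balanced_move P v.
Proof. by rewrite /balanced_move black_neighboursD1. Qed.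

(** A build-up unfolds from its first move; reversing a dismantling requires peeling off the last
    one. *)
Lemma buildup_rcons n d (s : seq (cube n d)) v P Q :
  buildup P (rcons s v) Q = (v \in Q) && buildup_move (Q :\ v) v && buildup P s (Q :\ v).
Proof.
elim: s P => [|w s IHs] P /=; last by rewrite IHs andbCA.
apply/andP/andP => [[/andP[vP c] /eqP <-]|[/andP[vQ c] /eqP ->]].
  by rewrite setU11 setU1K // /buildup_move vP c.
by rewrite c setD1K.
Qed.

Lemma balanced_buildup_rcons n d (s : seq (cube n d)) v P Q :
  buildup P s Q ->
  balanced_buildup P (rcons s v) = balanced_buildup P s && balanced_move Q v.
Proof.
elim: s P => [|w s IHs] P /= => [/eqP-> |/andP[_ /IHs->]]; last by rewrite andbA.
by rewrite andbT.
Qed.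

(** A cube is not its own neighbour, so its black neighbours are the same before and after its
    removal. *)
Lemma buildup_rev n d (s : seq (cube n d)) P Q :
  buildup P (rev s) Q = dismantling Q s P.
Proof.
elim: s Q => [|v s IHs] Q /=; first by rewrite eq_sym.
rewrite rev_cons buildup_rcons IHs /buildup_move /dismantling_move.
by rewrite black_neighboursD1 in_setD1 eqxx.
Qed.

Lemma balanced_buildup_rev n d (s : seq (cube n d)) P Q :
  dismantling Q s P -> balanced_buildup P (rev s) = balanced_dismantling Q s.
Proof.
elim: s Q => [//|v s IHs] Q /= /andP[_ ds].
rewrite rev_cons (@balanced_buildup_rcons _ _ _ _ _ (Q :\ v)) ?buildup_rev //.
by rewrite balanced_moveD1 (IHs _ ds) andbC.
Qed.

Theorem proposition2 (n d : nat) (n_gt0 : 0 < n) (d_gt0 : 0 < d)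
    (B : {set cube n d}) (solB : solution B) :
  [<-> convex B;
       perfect B;
       latin_hypercube [set [set z] | z : 'I_n] (set_array B);
       exists s, dismantling [set: cube n d] s B
                 /\ balanced_dismantling [set: cube n d] s;
       forall s, dismantling [set: cube n d] s B ->
                 balanced_dismantling [set: cube n d] s;
       exists s, buildup B s [set: cube n d] /\ balanced_buildup B s;
       forall s, buildup B s [set: cube n d] -> balanced_buildup B s].
Proof.
(* With dimension [d.+1], the [d.-1] in [set_array] reduces to [d], as the array lemmas require. *)
case: d d_gt0 B solB => [//|d] _ B [bB [s0 ds0]].
have conv_perf cB : perfect B := injective_perfect bB (convex_injective bB cB).
have all_bal (cB : convex B) s : dismantling setT s B -> balanced_dismantling setT s.
  exact: perfect_balanced_dismantling (@convexT _ _) (conv_perf cB).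
have bal_conv s : dismantling setT s B -> balanced_dismantling setT s -> convex B.
  exact: balanced_dismantling_convex (@convexT _ _).
tfae.
- exact: conv_perf.
- exact: perfect_latin.
- move=> /latin_injective/injective_convex cB.
  by exists s0; split; last exact: all_bal.
- by move=> [s [ds bs]]; apply/all_bal/(bal_conv s).
- move=> h; exists (rev s0); rewrite buildup_rev; split=> //.
  by rewrite (balanced_buildup_rev ds0) h.
(* Reversing [s] gives a balanced dismantling, so [B] is convex; hence the reverse of any build-up
   [t] is balanced. *)
- move=> [s]; rewrite -(revK s) buildup_rev => -[ds].
  rewrite (balanced_buildup_rev ds) => /(bal_conv _ ds)/all_bal h t.
  by rewrite -(revK t) buildup_rev => dt; rewrite (balanced_buildup_rev dt) h.
- move=> h; apply: (bal_conv s0) => //.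
  by rewrite -(balanced_buildup_rev ds0) h // buildup_rev.
Qed.
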